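(* Let $\mathbf{K}$ and $\mathbf{L}$ be classes of compacta, each closed under ultracopowers, and let $\alpha<\omega$. Suppose $\mathrm{Lev}_{\geq\alpha}(\mathbf{K},\mathbf{L})=\mathrm{Lev}_{\geq\alpha+1}(\mathbf{K},\mathbf{L})$ and $\mathrm{Lev}_{\geq\alpha}(\mathbf{L},\mathbf{K})=\mathrm{Lev}_{\geq\alpha+1}(\mathbf{L},\mathbf{K})$. Then $\mathrm{Lev}_{\geq\alpha}(\mathbf{K},\mathbf{L})=\mathrm{Lev}_{\geq\omega}(\mathbf{K},\mathbf{L})$ and $\mathrm{Lev}_{\geq\alpha}(\mathbf{L},\mathbf{K})=\mathrm{Lev}_{\geq\omega}(\mathbf{L},\mathbf{K})$.
   Context: A compactum is a compact Hausdorff space; classes of compacta are taken closed under homeomorphism. For a compactum $X$ and an ultrafilter $\mathcal{D}$ on a set $I$, the ultracopower $XI\backslash\mathcal{D}$ is the subspace of $\beta(X\times I)$ ($I$ discrete) of points mapped to $\mathcal{D}\in\beta(I)$ by the Stone–Čech extension of the projection to $I$; the codiagonal $p_{X,\mathcal{D}}:XI\backslash\mathcal{D}\to X$ is the restriction of the Stone–Čech extension of the projection $X\times I\to X$. A class $\mathbf{K}$ is closed under ultracopowers if $X\in\mathbf{K}$ implies $XI\backslash\mathcal{D}\in\mathbf{K}$ for every set $I$ and ultrafilter $\mathcal{D}$ on $I$. A continuous map $f:X\to Y$ is co-elementary if there are ultrafilters $\mathcal{D}$ on $I$, $\mathcal{E}$ on $J$ and a homeomorphism $h:XI\backslash\mathcal{D}\to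 YJ\backslash\mathcal{E}$ with $f\circ p_{X,\mathcal{D}}=p_{Y,\mathcal{E}}\circ h$. Levels: a function $f:X\to Y$ between compacta is of level $\geq0$ iff it is a continuous surjection; of level $\geq\alpha+1$ iff there are a compactum $Z$, a co-elementary map $g:Z\to Y$ and a map $h:Z\to X$ of level $\geq\alpha$ with $g=f\circ h$; for a limit ordinal $\lambda>0$, of level $\geq\lambda$ iff of level $\geq\alpha$ for all $\alpha<\lambda$. $\mathrm{Lev}_{\geq\alpha}(\mathbf{K},\mathbf{L})$ denotes the class of maps of level $\geq\alpha$ whose domain is in $\mathbf{K}$ and whose codomain is in $\mathbf{L}$. *)

(* Defs.v *)
From HB Require Import structures.
From mathcomp Require Import all_boot all_order all_algebra.
From mathcomp Require Import all_classical all_reals all_analysis.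
From mathcomp Require Import Rstruct Rstruct_topology.

Set Implicit Arguments.
Unset Strict Implicit.
Unset Printing Implicit Defensive.

Import Order.TTheory GRing.Theory Num.Theory.
Import numFieldNormedType.Exports.

Local Open Scope classical_set_scope.
Local Open Scope ring_scope.

Record compactum := Compactum {
  compactum_space :> topologicalType;
  compactum_compact : compact [set: compactum_space];
  compactum_hausdorff : hausdorff_space compactum_space }.

Definition homeomorphism (X Y : topologicalType) (h : X -> Y) :=
  continuous h /\
  exists k : Y -> X, [/\ continuous k, cancel h k & cancel k h].

Lemma set_type_compact (X : topologicalType) (A : set X) :
  compact A -> compact [set: set_type A].
Proof.
move=> cA F PF _.
have FA : (set_val @ F) A.
  by apply: (@filterS _ F _ setT) filterT => x _; exact: set_valP.
have [x [Ax Fx]] := cA (set_val @ F) (fmap_proper_filter _ PF) FA.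
exists (exist _ x (mem_set Ax)); split => // U V FU.
rewrite nbhsE => -[_ [[W oW <-] Wx] WV].
have FU' : (set_val @ F) (set_val @` U).
  exact: filterS (@preimage_image _ _ set_val U) FU.
have [_ [[y Uy <-] Wy]] := Fx _ _ FU' (open_nbhs_nbhs (conj oW Wx)).
by exists y; split => //; apply: WV.
Qed.

Lemma set_type_hausdorff (X : topologicalType) (A : set X) :
  hausdorff_space X -> hausdorff_space (set_type A).
Proof.
move=> hX x y xy; apply: val_inj; apply: hX => U V Ux Vy.
have cv := @initial_continuous A X set_val.
have [z [Uz Vz]] := xy _ _ (cv x _ Ux) (cv y _ Vy).
by exists (set_val z).
Qed.

Definition closed_subcompactum (X : compactum) (A : set X)
    (clA : closed A) : compactum :=
  Compactum
    (set_type_compact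
       (subclosed_compact clA (@compactum_compact X) (@subsetT _ A)))
    (@set_type_hausdorff _ A (@compactum_hausdorff X)).

Definition unit_interval : compactum :=
  @Compactum (set_type (`[0, 1]%classic : set Rdefinitions.R))
    (set_type_compact (@segment_compact _ _ _))
    (@set_type_hausdorff _ _ (@Rhausdorff _)).

Definition cube_index (S : topologicalType) :=
  {f : S -> unit_interval | continuous f}.

Definition cube (S : topologicalType) : topologicalType :=
  prod_topology (fun _ : {classic cube_index S} => unit_interval).

Definition cube_eval (S : topologicalType) (s : S) : cube S :=
  fun f => sval f s.

Lemma cube_hausdorff (S : topologicalType) : hausdorff_space (cube S).
Proof.
apply: (@hausdorff_product {classic cube_index S} (fun=> unit_interval)) => _.
exact: compactum_hausdorff.
Qed.

Lemma cube_compact (S : topologicalType) : compact [set: cube S].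
Proof.
have := @tychonoff {classic cube_index S} (fun=> unit_interval) (fun=> setT)
  (fun=> @compactum_compact unit_interval).
by congr (compact _); rewrite eqEsubset.
Qed.

Definition cube_compactum (S : topologicalType) : compactum :=
  Compactum (@cube_compact S) (@cube_hausdorff S).

(* [beta S] is the closure of the canonical image of [S] in the cube indexed by
   the continuous maps from [S] to [0, 1]; [beta_ext] below is its universal
   property. *)
Definition beta (S : topologicalType) : compactum :=
  @closed_subcompactum (cube_compactum S) _
    (@closed_closure _ (range (@cube_eval S))).

Definition beta_in (S : topologicalType) (s : S) : beta S :=
  exist _ (cube_eval s) (mem_set (subset_closure (imageT _ s))).

Lemma cube_proj_continuous (S : topologicalType) (f : cube_index S) :
  continuous (fun x : cube S => x f).
Proof. exact: (@proj_continuous {classic cube_index S} (fun=> unit_interval)). Qed.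

Lemma cube_cvg (S : topologicalType) (F : set_system (cube S)) (x : cube S) :
  Filter F -> (forall f : cube_index S, (fun y : cube S => y f) @ F --> x f) -> F --> x.
Proof.
move=> FF Fx; apply/cvg_sup => f U [_ [[W oW <-] Wx] WU].
by apply: filterS WU _; apply: Fx; exact: open_nbhs_nbhs.
Qed.

Lemma beta_in_continuous (S : topologicalType) : continuous (@beta_in S).
Proof.
have ce : continuous (@cube_eval S).
  by move=> s; apply: cube_cvg => f; exact: (proj2_sig f s).
move=> s U [_ [[W oW <-] Ws] WU].
have nW : nbhs s (@cube_eval S @^-1` W) by apply: ce; exact: open_nbhs_nbhs.
by apply: filterS nW => t; exact: (WU (beta_in t)).
Qed.

Lemma beta_in_dense (S : topologicalType) : closure (range (@beta_in S)) = setT.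
Proof.
rewrite -subTset => p _ U [_ [[W oW <-] Wp] WU].
have [_ [[s _ <-] Ws]] := set_valP p _ (open_nbhs_nbhs (conj oW Wp)).
by exists (beta_in s); split; [exists s|exact: WU].
Qed.

Lemma unit_interval_separates (C : compactum) (c : C) (U : set C) :
  nbhs c U -> exists (u : C -> unit_interval) (V : set unit_interval),
    [/\ continuous u, nbhs (u c) V & forall d, V (u d) -> U d].
Proof.
rewrite nbhsE => -[W [oW Wc] WU].
have := @normal_completely_regular Rdefinitions.R C
  (compact_normal (@compactum_hausdorff C) (@compactum_compact C))
  (hausdorff_accessible (@compactum_hausdorff C)) c (~` W)
  (open_closedC oW) (fun h => h Wc).
move=> /(@uniform_separatorP _ Rdefinitions.R)[f [cf f01 fc fW]].
have fI x : f x \in `[0, 1]%classic by apply/mem_set/f01; exists x.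
exists (fun x => exist _ (f x) (fI x)), (set_val @^-1` `]-oo, 1[%classic).
split.
- move=> x A [_ [[B oB <-] Bx] BA].
  have nB : nbhs x (f @^-1` B) by apply: cf; exact: open_nbhs_nbhs.
  by apply: filterS nB => y; exact: (BA (exist _ (f y) (fI y))).
- apply: initial_continuous; apply: open_nbhs_nbhs; split.
    exact: interval_open.
  have fc0 : f c = 0 by apply: fc; exists c.
  by change (is_true (f c \in `]-oo, 1[)); rewrite fc0 in_itv /= ltr01.
- move=> d; change (is_true (f d \in `]-oo, 1[) -> U d).
  rewrite in_itv /= => fd1; apply: WU; apply: contrapT => nWd.
  suff fd : f d = 1 by rewrite fd ltxx in fd1.
  by apply: fW; exists d.
Qed.

Lemma unit_interval_separates_eq (C : compactum) (c d : C) :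
  (forall u : C -> unit_interval, continuous u -> u c = u d) -> c = d.
Proof.
move=> ucd; apply: (@compactum_hausdorff C) => A B Ac Bd.
have [u [V [cu Vc VA]]] := unit_interval_separates Ac.
exists d; split; last exact: nbhs_singleton.
by apply: VA; rewrite -ucd //; exact: nbhs_singleton.
Qed.

Lemma beta_ext_exists (S : topologicalType) (C : compactum) (f : S -> C) :
  continuous f ->
  exists g : beta S -> C, continuous g /\ forall s, g (beta_in s) = f s.
Proof.
move=> cf.
have cuf (u : cube_index C) : continuous (sval u \o f).
  by move=> s; apply: continuous_comp; [exact: cf|exact: proj2_sig u _].
pose uf u : cube_index S := exist _ _ (cuf u).
have /choice[g gE] (p : beta S) :
    exists c, forall u, sval u c = set_val p (uf u).
  pose G := filter_from (nbhs (set_val p : cube S)) (preimage (@cube_eval S)).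
  have PG : ProperFilter G.
    apply: filter_from_proper; last first.
      move=> W /(set_valP p)[_ [[s _ <-] Ws]]; by exists s.
    apply: filter_from_filter; first by exists setT; exact: filterT.
    by move=> A B pA pB; exists (A `&` B) => //; exact: filterI.
  have [c [_ fGc]] := @compactum_compact C (f @ G) (fmap_proper_filter _ PG) filterT.
  exists c => u; apply: (@compactum_hausdorff unit_interval) => A B Ac Bp.
  have GB : (f @ G) (f @` (@cube_eval S @^-1` [set x | B (x (uf u))])).
    exists [set x | B (x (uf u))]; first exact: cube_proj_continuous Bp.
    exact: preimage_image.
  have [_ [[s Bs <-] As]] := fGc _ _ GB (proj2_sig u c _ Ac).
  by exists (sval u (f s)).
exists g; split.
  move=> p U /unit_interval_separates[u [V [cu Vgp VU]]].
  have cv : continuous (fun q : beta S => set_val q (uf (exist _ u cu))).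
    move=> q; apply: (@continuous_comp (beta S) (cube S) unit_interval
      set_val (fun x => x (uf (exist _ u cu)))).
      exact: initial_continuous.
    exact: cube_proj_continuous.
  have pV : nbhs (set_val p (uf (exist _ u cu))) V by rewrite -gE.
  have nV : nbhs p [set q | V (set_val q (uf (exist _ u cu)))] by exact: cv pV.
  by apply: filterS nV => q; rewrite /= -gE; exact: VU.
move=> s; apply: unit_interval_separates_eq => u cu.
exact: (gE _ (exist _ u cu)).
Qed.

Lemma beta_ext_unique (S : topologicalType) (C : compactum) (g g' : beta S -> C) :
  continuous g -> continuous g' ->
  (forall s : S, g (beta_in s) = g' (beta_in s)) -> g = g'.
Proof.
move=> cg cg' gg'; apply/funext => p; apply: (@compactum_hausdorff C) => A B Ap Bp.
have pAB : nbhs p (g @^-1` A `&` g' @^-1` B).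
  by apply: filterI; [exact: cg|exact: cg'].
have : closure (range (@beta_in S)) p by rewrite beta_in_dense.
move=> /(_ _ pAB)[_ [[s _ <-] [As Bs]]].
by exists (g (beta_in s)); split => //; rewrite gg'.
Qed.

Definition beta_ext (S : topologicalType) (C : compactum) (f : S -> C)
    (cf : continuous f) : beta S -> C :=
  sval (cid (beta_ext_exists cf)).

Lemma beta_ext_continuous (S : topologicalType) (C : compactum) (f : S -> C)
  (cf : continuous f) : continuous (beta_ext cf).
Proof. by rewrite /beta_ext; case: cid => g []. Qed.

Lemma beta_extE (S : topologicalType) (C : compactum) (f : S -> C)
  (cf : continuous f) (s : S) : beta_ext cf (beta_in s) = f s.
Proof. by rewrite /beta_ext; case: cid => g []. Qed.

Lemma ultrafilter_beta_cvg (I : choiceType) (D : set_system I) :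
  UltraFilter D ->
  exists q, (@beta_in (discrete_topology I)) @ D --> (q : beta (discrete_topology I)).
Proof.
move=> UD; have PD : ProperFilter D by exact: ultra_proper.
have [q [_ Dq]] := @compactum_compact (beta (discrete_topology I))
  (@beta_in (discrete_topology I) @ D) (fmap_proper_filter _ PD) filterT.
exists q => A Aq.
have [//|DA] := in_ultra_setVsetC (@beta_in (discrete_topology I) @^-1` A) UD.
by have [x []] := Dq (~` A) A DA Aq.
Qed.

Section Ultracopower.
Context (X : compactum) (I : choiceType).

Definition copower : topologicalType := (X * discrete_topology I)%type.

Definition copower_fst : copower -> X := fst.
Definition copower_index (s : copower) : beta (discrete_topology I) :=
  beta_in s.2.

Lemma copower_fst_continuous : continuous copower_fst.
Proof. by move=> x; exact: cvg_fst. Qed.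

Lemma copower_index_continuous : continuous copower_index.
Proof.
by move=> x; apply: continuous_comp; [exact: cvg_snd|exact: beta_in_continuous].
Qed.

Context (D : set_system I) (UD : UltraFilter D).

(* The ultrafilter [D] is identified with the point of [beta I] to which its
   image under the inclusion of [I] converges ([ultrafilter_beta_cvg]). *)
Definition ultracopower_set : set (beta copower) :=
  [set p | (@beta_in (discrete_topology I)) @ D
             --> beta_ext copower_index_continuous p].

Lemma ultracopower_set_closed : closed ultracopower_set.
Proof.
have PD : ProperFilter D by exact: ultra_proper.
have hB := @compactum_hausdorff (beta (discrete_topology I)).
have [[p0 p0E]|/forallNP no] := pselect (exists p, ultracopower_set p).
  have -> : ultracopower_set =
    beta_ext copower_index_continuous @^-1` [set beta_ext copower_index_continuous p0].
    rewrite eqEsubset; split => p /=; last by rewrite /ultracopower_set /= => ->.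
    by move=> pE; apply: (cvg_unique hB pE p0E).
  apply: preimage_closed => [q _|]; first exact: beta_ext_continuous.
  exact/accessible_closed_set1/hausdorff_accessible.
suff -> : ultracopower_set = set0 by exact: closed0.
by rewrite -subset0 => p /no.
Qed.

Definition ultracopower : compactum :=
  closed_subcompactum ultracopower_set_closed.

Definition codiagonal : ultracopower -> X :=
  fun p => beta_ext copower_fst_continuous (set_val p).

End Ultracopower.

Arguments ultracopower X {I D} UD.
Arguments codiagonal X {I D} UD _.

Definition coelementary (X Y : compactum) (f : X -> Y) :=
  continuous f /\
  exists (I : choiceType) (D : set_system I) (UD : UltraFilter D)
         (J : choiceType) (E : set_system J) (UE : UltraFilter E)
         (h : ultracopower X UD -> ultracopower Y UE),
    homeomorphism h /\ f \o codiagonal X UD = codiagonal Y UE \o h.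

Definition map_class := forall X Y : compactum, set (X -> Y).

(* Only the levels up to the first limit ordinal are needed: [level_ge n] for
   finite ordinals and [level_ge_omega] for omega. *)
Fixpoint level_ge (n : nat) : map_class := fun X Y =>
  if n is m.+1 then
    [set f : X -> Y | exists (Z : compactum) (g : Z -> Y) (h : Z -> X),
      [/\ coelementary g, level_ge m h & g = f \o h]]
  else [set f : X -> Y | continuous f /\ range f = setT].

Definition level_ge_omega : map_class := fun X Y =>
  [set f : X -> Y | forall n, level_ge n f].

Definition maps_between (M : map_class) (K L : compactum -> Prop) : map_class :=
  fun X Y => [set f : X -> Y | [/\ K X, L Y & M X Y f]].

Definition closed_under_homeomorphism (K : compactum -> Prop) :=
  forall X Y : compactum, (exists h : X -> Y, homeomorphism h) -> K X -> K Y.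

Definition closed_under_ultracopowers (K : compactum -> Prop) :=
  forall (X : compactum) (I : choiceType) (D : set_system I)
    (UD : UltraFilter D), K X -> K (ultracopower X UD).

(* Main.v *)
(* Say that two finite tuples of [0, 1]-valued maps, on spaces X and Y, are
   close at rank n when they are close in the n-round Ehrenfeucht-Fraisse game
   in which each round adjoins a block of such maps. These pseudometrics are
   totally bounded, uniformly in the space, so by the Tietze theorem they
   satisfy a Los theorem for ultracopowers; hence co-elementary maps preserve
   them at every rank. It follows that f has level >= n exactly when pulling
   back along f preserves the rank-n pseudometric. Moreover, if f : X -> Y
   preserves rank n + 1, then a fine enough ultrafilter on the finite sets of
   maps glues approximate answers to all finite tuples on X into a map h of
   level >= n from an ultracopower of Y to X with f o h the codiagonal. This
   makes the middle map h of a map of level >= n + 1 in Lev(K, L) a member of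
   Lev(L, K), so the two hypotheses can be applied alternately; no
   Keisler-Shelah theorem is needed. *)

Require Import Defs.
From mathcomp Require Import all_boot all_order all_algebra.
From mathcomp Require Import all_classical all_reals all_analysis.
From mathcomp Require Import Rstruct Rstruct_topology.
From mathcomp Require Import lra.

Set Implicit Arguments.
Unset Strict Implicit.
Unset Printing Implicit Defensive.

Import Order.TTheory GRing.Theory Num.Theory.
Import numFieldNormedType.Exports.

Local Open Scope classical_set_scope.
Local Open Scope ring_scope.

Local Notation R := Rdefinitions.R.

(** * Functions to the unit interval and finite tuples of them *)

Lemma cube_index_inj (X : topologicalType) (b c : cube_index X) :
  (forall x, sval b x = sval c x) -> b = c.
Proof.
case: b c => [b cb] [c cc] /= /funext bc; case: _ / bc in cc *.
by congr exist; exact: Prop_irrelevance.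
Qed.

Lemma comp_cube_index_continuous (X Y : topologicalType) (f : X -> Y)
    (b : cube_index Y) :
  continuous f -> continuous (sval b \o f).
Proof.
by move=> cf x; apply: continuous_comp; [exact: cf|exact: (proj2_sig b)].
Qed.

Definition pullback (X Y : topologicalType) (f : X -> Y) (cf : continuous f)
    (b : cube_index Y) : cube_index X :=
  exist _ _ (@comp_cube_index_continuous _ _ f b cf).

Lemma unit_interval_0 : 0 \in (`[0, 1]%classic : set R).
Proof. by apply/mem_set; rewrite /= in_itv /= lexx ler01. Qed.

Definition unit_zero : unit_interval := exist _ 0 unit_interval_0.

Lemma cst_unit_continuous (X : topologicalType) (t : unit_interval) :
  continuous (fun _ : X => t).
Proof. by move=> x; exact: cvg_cst. Qed.

Definition zero_index (X : topologicalType) : cube_index X :=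
  exist _ (fun=> unit_zero) (@cst_unit_continuous X unit_zero).

Definition join_env (V W T : Type) (a : V -> T) (c : W -> T) (z : V + W) : T :=
  match z with inl v => a v | inr w => c w end.

Lemma comp_join_env (V W T U : Type) (g : T -> U) (a : V -> T) (c : W -> T) :
  g \o join_env a c = join_env (g \o a) (g \o c).
Proof. by apply/funext => -[]. Qed.

(* The Ehrenfeucht-Fraisse distance of rank [n] between the finite tuples [a]
   and [b]: each move adds a block of [k.+1] functions, and the final positions
   are compared by the Hausdorff distance of their ranges in the cube. *)
Fixpoint ef_close (n k : nat) (e : R) (X Y : topologicalType) (V : finType) :
    (V -> cube_index X) -> (V -> cube_index Y) -> Prop :=
  if n is m.+1 then fun a b =>
    (forall c : 'I_k.+1 -> cube_index X, exists d : 'I_k.+1 -> cube_index Y,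
       @ef_close m k e X Y (V + 'I_k.+1)%type (join_env a c) (join_env b d)) /\
    (forall d : 'I_k.+1 -> cube_index Y, exists c : 'I_k.+1 -> cube_index X,
       @ef_close m k e X Y (V + 'I_k.+1)%type (join_env a c) (join_env b d))
  else fun a b =>
    (forall x, exists y, forall v, ball (sval (a v) x) e (sval (b v) y)) /\
    (forall y, exists x, forall v, ball (sval (a v) x) e (sval (b v) y)).

(** * Metric properties and total boundedness of the game distance *)

Section EfClose.
Variable k : nat.
Implicit Types (X Y Z : topologicalType) (V W : finType) (e : R).

Lemma ef_close_sym n e X Y V (a : V -> cube_index X) (b : V -> cube_index Y) :
  ef_close n k e a b -> ef_close n k e b a.
Proof.
elim: n V a b => [|n IH] V a b /= [ab ba]; split.
- by move=> y; have [x xy] := ba y; exists x => v; exact/ball_sym.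
- by move=> x; have [y xy] := ab x; exists y => v; exact/ball_sym.
- by move=> d; have [c cd] := ba d; exists c; exact: IH.
- by move=> c; have [d cd] := ab c; exists d; exact: IH.
Qed.

Lemma ef_close_trans n e1 e2 X Y Z V (a : V -> cube_index X)
    (b : V -> cube_index Y) (c : V -> cube_index Z) :
  ef_close n k e1 a b -> ef_close n k e2 b c -> ef_close n k (e1 + e2) a c.
Proof.
elim: n V a b c => [|n IH] V a b c /= [ab ba] [bc cb]; split.
- move=> x; have [y xy] := ab x; have [z yz] := bc y; exists z => v.
  exact: ball_triangle (xy v) (yz v).
- move=> z; have [y yz] := cb z; have [x xy] := ba y; exists x => v.
  exact: ball_triangle (xy v) (yz v).
- move=> p; have [q pq] := ab p; have [r qr] := bc q; exists r.
  exact: IH pq qr.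
- move=> r; have [q qr] := cb r; have [p pq] := ba q; exists p.
  exact: IH pq qr.
Qed.

Lemma ef_closeW n e e' X Y V (a : V -> cube_index X) (b : V -> cube_index Y) :
  e <= e' -> ef_close n k e a b -> ef_close n k e' a b.
Proof.
move=> ee'; elim: n V a b => [|n IH] V a b /= [ab ba]; split.
- by move=> x; have [y xy] := ab x; exists y => v; exact: le_ball ee' _ (xy v).
- by move=> y; have [x xy] := ba y; exists x => v; exact: le_ball ee' _ (xy v).
- by move=> c; have [d cd] := ab c; exists d; exact: IH.
- by move=> d; have [c cd] := ba d; exists c; exact: IH.
Qed.

(** Coordinates may be dropped, repeated or permuted: a shorter block is padded to length [k.+1],
    answered, and the answer is cut back. *)
Lemma ef_close_reindex n k' e X Y V W (s : W -> V)
    (a : V -> cube_index X) (b : V -> cube_index Y) :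
  (k' <= k)%N ->
  ef_close n k e a b -> ef_close n k' e (a \o s) (b \o s).
Proof.
move=> kk'.
have kS : (k'.+1 <= k.+1)%N by [].
(* Out of range, [inord] returns the index 0, so the padding repeats [c] at 0. *)
pose ext (T : Type) (c : 'I_k'.+1 -> T) (i : 'I_k.+1) := c (inord i).
have extK T (c : 'I_k'.+1 -> T) : ext T c \o widen_ord kS = c.
  by apply/funext => i; rewrite /ext /= inord_val.
elim: n V W s a b => [|n IH] V W s a b /= [ab ba].
  split=> x; [have [y xy] := ab x|have [y xy] := ba x];
  by exists y => w; exact: xy.
pose s' (z : W + 'I_k'.+1) : V + 'I_k.+1 :=
  match z with inl w => inl (s w) | inr i => inr (widen_ord kS i) end.
have joinE (T : Type) (u : V -> T) (c : 'I_k.+1 -> T) :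
    join_env (u \o s) (c \o widen_ord kS) = join_env u c \o s'.
  by apply/funext => -[].
split=> c.
  have [d /(IH _ _ s')] := ab (ext _ c).
  by rewrite -!joinE extK; exists (d \o widen_ord kS).
have [d /(IH _ _ s')] := ba (ext _ c).
by rewrite -!joinE extK; exists (d \o widen_ord kS).
Qed.

(** One round is spent on a block of zero functions, and that block is then forgotten by reindexing
    along [inl]. *)
Lemma ef_close_pred n e X Y V (a : V -> cube_index X) (b : V -> cube_index Y) :
  ef_close n.+1 k e a b -> ef_close n k e a b.
Proof.
move=> [/(_ (fun=> zero_index X))[d]] /(ef_close_reindex inl (leqnn k)) + _.
exact.
Qed.

Lemma ef_close_0 n e X Y V (a : V -> cube_index X) (b : V -> cube_index Y) :
  ef_close n k e a b -> ef_close 0 k e a b.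
Proof. by elim: n => // n IH /ef_close_pred. Qed.

Lemma unit_interval_coloring e : 0 < e ->
  exists (T : finType) (g : unit_interval -> T),
    forall s t, g s = g t -> ball s e t.
Proof.
move=> e0; pose N := (Num.truncn e^-1).+1.
have Ne : N%:R^-1 < e.
  by rewrite invf_plt ?posrE ?ltr0n // truncnS_gt.
(* The colours are cells of length 1/N < e; the extra colour [N] is taken by the point 1. *)
exists 'I_N.+1, (fun t => inord (Num.truncn (N%:R * set_val t))) => s t.
have rng (u : unit_interval) : 0 <= (set_val u : R) <= 1.
  by have := set_valP u; rewrite /= in_itv.
have trN (u : unit_interval) : (Num.truncn (N%:R * (set_val u : R)) < N.+1)%N.
  have /andP[u0 u1] := rng u.
  have h : 0 <= N%:R * (set_val u : R) by rewrite mulr_ge0 ?ler0n.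
  have /andP[+ _] := truncn_itv h.
  by rewrite ltnS -(@ler_nat R) => /le_trans; apply; rewrite ler_piMr ?ler0n.
move=> /(congr1 (@nat_of_ord _)); rewrite !inordK // => tr.
suff : `|(set_val s : R) - set_val t| < e by [].
have N0 : 0 < (N%:R : R) by rewrite ltr0n.
rewrite -(ltr_pM2l N0) -[X in X * `|_|](gtr0_norm N0) -normrM mulrBr.
have /andP[s0 _] := rng s; have /andP[t0 _] := rng t.
have := truncn_itv (mulr_ge0 (ltW N0) s0).
have := truncn_itv (mulr_ge0 (ltW N0) t0); rewrite tr -natr1.
move: Ne; rewrite -(ltr_pM2l N0) mulfV ?gt_eqF //.
move=> Ne /andP[t1 t2] /andP[s1 s2]; rewrite ltr_norml; apply/andP; lra.
Qed.

(* Total boundedness of the pseudometric, uniformly in the space. *)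
Lemma ef_close_coloring n e V : 0 < e ->
  exists (T : finType) (g : forall X, (V -> cube_index X) -> T),
    forall X Y (a : V -> cube_index X) (b : V -> cube_index Y),
      g X a = g Y b -> ef_close n k e a b.
Proof.
move=> e0; elim: n V => [|n IH] V.
  have [T [g gP]] := unit_interval_coloring e0.
  (* At rank 0 the colour of a tuple is the set of coloured value vectors that it takes on the
     space. *)
  exists {set {ffun V -> T}}, (fun X a => [set u : {ffun V -> T} |
    `[< exists x, u = [ffun v => g (sval (a v) x)] >]]%SET) => X Y a b ab.
  split=> x.
    have : [ffun v => g (sval (a v) x)] \in
        [set u | `[< exists x, u = [ffun v => g (sval (b v) x)] >]]%SET.
      by rewrite -ab inE; apply/asboolP; exists x.
    rewrite inE => /asboolP[y xy]; exists y => v; apply: gP.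
    by have /ffunP/(_ v) := xy; rewrite !ffunE.
  have : [ffun v => g (sval (b v) x)] \in
      [set u | `[< exists x, u = [ffun v => g (sval (a v) x)] >]]%SET.
    by rewrite ab inE; apply/asboolP; exists x.
  rewrite inE => /asboolP[y xy]; exists y => v; apply: gP.
  by have /ffunP/(_ v) := xy; rewrite !ffunE.
have [T [g gP]] := IH (V + 'I_k.+1)%type.
(* At higher rank it is the set of colours of all extensions by one block, so equal colours provide
   a reply to every move. *)
exists {set T}, (fun X a => [set t |
  `[< exists c, t = g X (join_env a c) >]]%SET) => X Y a b ab.
split=> c.
  have : g X (join_env a c) \in
      [set t | `[< exists c, t = g Y (join_env b c) >]]%SET.
    by rewrite -ab inE; apply/asboolP; exists c.
  by rewrite inE => /asboolP[d] /gP; exists d.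
have : g Y (join_env b c) \in
    [set t | `[< exists c, t = g X (join_env a c) >]]%SET.
  by rewrite ab inE; apply/asboolP; exists c.
by rewrite inE => /asboolP[d] /esym /gP; exists d.
Qed.

End EfClose.

(** * Functions on an ultracopower and the Los theorem *)

Lemma ultra_cvg (I : Type) (D : set_system I) (C : compactum) (u : I -> C) :
  UltraFilter D -> exists q : C, u @ D --> q.
Proof.
move=> UD; have PD : ProperFilter D by exact: ultra_proper.
have [q [_ Dq]] :=
  @compactum_compact C (u @ D) (fmap_proper_filter _ PD) filterT.
exists q => A Aq.
have [//|DA] := in_ultra_setVsetC (u @^-1` A) UD.
by have [x []] := Dq (~` A) A DA Aq.
Qed.

Section UltracopowerFunctions.
Variables (X : compactum) (I : choiceType) (D : set_system I).
Variable UD : UltraFilter D.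

Lemma family_continuous (A : I -> cube_index X) :
  continuous (fun s : copower X I => sval (A s.2) s.1).
Proof.
move=> [x i] U /(proj2_sig (A i)) nU.
exists ([set y | U (sval (A i) y)], [set i]) => /=.
  by split=> //; apply: discrete_set1.
by move=> [y j] /= [Uy ->].
Qed.

Lemma codiagonal_continuous : continuous (codiagonal X UD).
Proof.
move=> p; apply: (@continuous_comp _ _ _ set_val).
  exact: initial_continuous.
exact: beta_ext_continuous.
Qed.

(** The function on the ultracopower that plays the role of the class of the family [A] in an
    ultraproduct. *)
Definition ulim_fun (A : I -> cube_index X) (p : ultracopower X UD) :=
  beta_ext (@family_continuous A) (set_val p).

Lemma ulim_fun_continuous (A : I -> cube_index X) : continuous (ulim_fun A).
Proof.
move=> p; apply: (@continuous_comp _ _ _ set_val).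
  exact: initial_continuous.
exact: beta_ext_continuous.
Qed.

Definition ulim (A : I -> cube_index X) : cube_index (ultracopower X UD) :=
  exist _ (ulim_fun A) (@ulim_fun_continuous A).

(** Both sides extend to continuous maps on [beta (copower X I)] that agree on the dense copower.
    Thus pulling back along the codiagonal is dual to the diagonal embedding. *)
Lemma ulim_cst (b : cube_index X) :
  ulim (fun=> b) = pullback codiagonal_continuous b.
Proof.
apply: cube_index_inj => p /=; rewrite /ulim_fun /codiagonal.
pose g := sval b \o beta_ext (@copower_fst_continuous X I).
suff -> : beta_ext (@family_continuous (fun=> b)) = g by [].
apply: beta_ext_unique.
- exact: beta_ext_continuous.
- move=> q; apply: continuous_comp; first exact: beta_ext_continuous.
  exact: (proj2_sig b).
- by move=> s; rewrite /g /= !beta_extE.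
Qed.

(** The ultracopower is closed in a normal space, so the Tietze theorem extends [c]; the slices of
    the extension over the indices form the family. *)
Lemma ulim_surj (c : cube_index (ultracopower X UD)) : exists A, c = ulim A.
Proof.
pose B := beta (copower X I).
pose S : set B := @ultracopower_set X I D.
have clS : closed S by exact: ultracopower_set_closed.
have nB : normal_space B.
  exact: compact_normal (@compactum_hausdorff B) (@compactum_compact B).
pose f (p : set_type S) : R := set_val (sval c p).
have cf : continuous f.
  move=> p; apply: (@continuous_comp _ _ _ (sval c)).
    exact: (proj2_sig c).
  exact: initial_continuous.
have fE (p : set_type S) : valL_ 0 f (set_val p) = f p.
  by have /(congr1 (@^~ p)) := @valLK _ _ (0 : R) S f.
have [|x Sx|g [fg cg _]] :=
    @continuous_bounded_extension B R nB S clS (valL_ 0 f) 1 ltr01.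
- exact/(@subspace_valL_continuousP' B S R 0 f).
- rewrite -[x]/(set_val (exist _ x (mem_set Sx) : set_type S)) fE.
  have := set_valP (sval c (exist _ x (mem_set Sx))).
  by rewrite /= in_itv /= => /andP[h0 h1]; rewrite ger0_norm.
have cl01 (r : R) : Num.max 0 (Num.min r 1) \in (`[0, 1]%classic : set R).
  apply/mem_set; rewrite /= in_itv /= le_max lexx /= ge_max ler01 /=.
  by rewrite ge_min lexx orbT.
(* Clamping brings the real-valued extension back into [0, 1] without changing it on [S]. *)
pose h (q : B) : unit_interval :=
  exist _ (Num.max 0 (Num.min (g q) 1)) (cl01 (g q)).
have ch : continuous h.
  move=> q U [_ [[W oW <-] Wq] WU].
  have cm : continuous ((fun=> 0 : R^o) \max (g \min (fun=> 1 : R^o))).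
    move=> y; apply: (@continuous_max R B (fun=> 0) (g \min (fun=> 1)) y).
      exact: (@cst_continuous B R^o 0 y).
    apply: (@continuous_min R B g (fun=> 1) y); first exact: cg.
    exact: (@cst_continuous B R^o 1 y).
  have nW : nbhs q [set y | W (Num.max 0 (Num.min (g y) 1))].
    by apply: (cm q W); exact: open_nbhs_nbhs (conj oW Wq).
  change (nbhs q [set y | U (h y)]).
  apply: filterS nW => y Wy.
  exact: (WU (h y)).
have chi (i : I) : continuous (fun x : X => h (beta_in ((x, i) : copower X I))).
  move=> x; apply: (@continuous_comp X B unit_interval
    (fun x => beta_in ((x, i) : copower X I)) h); last exact: ch.
  apply: (@continuous_comp X (copower X I) B (fun x => (x, i))).
    move=> U [[P Q] /= [nP nQ] PQU]; apply: filterS nP => z Pz.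
    by apply: PQU; split=> //; exact: nbhs_singleton nQ.
  exact: beta_in_continuous.
exists (fun i => exist _ _ (chi i)); apply: cube_index_inj => p /=.
rewrite /ulim_fun.
have -> : beta_ext (@family_continuous (fun i => exist _ _ (chi i))) = h.
  apply: beta_ext_unique => //; first exact: beta_ext_continuous.
  by move=> [x i]; rewrite beta_extE.
apply: val_inj; rewrite /= -fg; last by apply/mem_set; exact: (set_valP p).
rewrite fE; have := set_valP (sval c p); rewrite /= in_itv /= => /andP[h0 h1].
by rewrite (min_idPl h1) (max_idPr h0).
Qed.

Lemma lim_in_ultracopower (x : I -> X) :
  exists p : ultracopower X UD,
    (fun i => beta_in ((x i, i) : copower X I)) @ D --> set_val p.
Proof.
have [q xq] := ultra_cvg (fun i => beta_in ((x i, i) : copower X I)) UD.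
have Sq : @ultracopower_set X I D q.
  have PD : ProperFilter D by exact: ultra_proper.
  have := cvg_comp _ _ xq
    (@beta_ext_continuous _ _ _ (@copower_index_continuous X I) q).
  have -> // : beta_ext (@copower_index_continuous X I) \o
     (fun i => beta_in ((x i, i) : copower X I)) =
     @beta_in (discrete_topology I).
  by apply/funext => i; rewrite /= beta_extE.
by exists (exist _ q (mem_set Sq)).
Qed.

(** The point is the limit of the pairs [(x i, i)] along [D], so one [p] serves all families at
    once. *)
Lemma ulim_cvg (x : I -> X) : exists p : ultracopower X UD,
  forall A : I -> cube_index X,
    (fun i => sval (A i) (x i)) @ D --> sval (ulim A) p.
Proof.
have [p xp] := lim_in_ultracopower x; exists p => A.
have := cvg_comp _ _ xp
  (@beta_ext_continuous _ _ _ (@family_continuous A) (set_val p)).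
have -> // : beta_ext (@family_continuous A) \o
   (fun i => beta_in ((x i, i) : copower X I)) = (fun i => sval (A i) (x i)).
by apply/funext => i; rewrite /= beta_extE.
Qed.

Lemma codiagonal_surj (x : X) : exists p, codiagonal X UD p = x.
Proof.
have PD : ProperFilter D by exact: ultra_proper.
have [p xp] := ulim_cvg (fun=> x).
exists p; apply: unit_interval_separates_eq => u cu.
have := xp (fun=> exist _ u cu); rewrite ulim_cst /=.
move=> /(cvg_unique (@compactum_hausdorff unit_interval)); apply.
exact: cvg_cst.
Qed.

(** The pairs [(x, i)] are dense in [beta (copower X I)], so one of them is close to [p]; the
    indicator [chi] of [B], extended to [beta I], is 1 at [D] and forces the index into [B]. *)
Lemma ultracopower_approx (V : finType) (A : V -> I -> cube_index X)
    (p : ultracopower X UD) (B : set I) (e : R) : D B -> 0 < e ->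
  exists i x, B i /\
    forall v, ball (sval (ulim (A v)) p) e (sval (A v i) x).
Proof.
move=> DB e0; have PD : ProperFilter D by exact: ultra_proper.
pose J := discrete_topology I.
have oneP : 1 \in (`[0, 1]%classic : set R).
  by apply/mem_set; rewrite /= in_itv /= lexx ler01.
pose one : unit_interval := exist _ 1 oneP.
pose chi (i : J) : unit_interval := if `[< B i >] then one else unit_zero.
have cchi : continuous chi.
  move=> i U Ui; change (nbhs i (chi @^-1` U)).
  apply: (@filterS _ (nbhs i) _ [set i]); last exact: discrete_set1.
  by move=> j ->; exact: nbhs_singleton Ui.
pose ind := beta_ext (@copower_index_continuous X I).
have /cvg_comp/(_ (@beta_ext_continuous _ _ _ cchi _)) := set_valP p.
rewrite -/ind => chip.
have ind1 : beta_ext cchi (ind (set_val p)) = one.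
  have chi1 : (fun i : J => beta_ext cchi (beta_in i)) @ D --> one.
    move=> U /nbhs_singleton U1.
    change (D [set i : J | U (beta_ext cchi (beta_in i))]).
    by apply: (filterS _ DB) => i Bi; rewrite /= beta_extE /chi asboolT.
  exact: (cvg_unique (@compactum_hausdorff unit_interval) chip chi1).
have nchi : nbhs (set_val p) [set q | ball one 1 (beta_ext cchi (ind q))].
  have c2 : continuous (beta_ext cchi \o ind).
    by move=> q; apply: continuous_comp; exact: beta_ext_continuous.
  by apply: c2; rewrite /= ind1; exact: nbhsx_ballx.
have nA v : nbhs (set_val p) [set q |
    ball (sval (ulim (A v)) p) e (beta_ext (@family_continuous (A v)) q)].
  by apply: beta_ext_continuous; exact: nbhsx_ballx.
have {}nA := @filter_forall _ V _ _ (nbhs_filter _) nA.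
have := @beta_in_dense (copower X I).
move=> /(congr1 (@^~ (set_val p))) /= /esym.
rewrite propeqE => -[+ _] => /(_ Logic.I).
move=> /(_ _ (@filterI _ _ (nbhs_filter _) _ _ nchi nA)).
move=> [_ [[[x i] _ <-] [/= chii Ai]]]; exists i, x; split.
  move: chii; rewrite /ind !beta_extE /chi /=.
  case: asboolP => // _ h; exfalso.
  have : `|(1 : R) - 0| < 1 by exact: h.
  by rewrite subr0 normr1 ltxx.
by move=> v; have := Ai v; rewrite beta_extE.
Qed.

(** Test the hypothesis on a [u] that picks a counterexample at every index having one, and [t0]
    elsewhere. *)
Lemma ultra_forall (T : Type) (P : I -> T -> Prop) :
  (forall u : I -> T, D [set i | P i (u i)]) -> D [set i | forall t, P i t].
Proof.
move=> DP; have PD : ProperFilter D by exact: ultra_proper.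
have [//|DN] := in_ultra_setVsetC [set i | forall t, P i t] UD; exfalso.
have [i0 /existsNP[t0 _]] := filter_ex DN.
have /choice[u uP] i : exists t, P i t -> forall t, P i t.
  have [/asboolP|/existsNP[t nt]] := pselect (forall t, P i t).
    by move=> /asboolP h; exists t0.
  by exists t.
have [i [/= Pi nPi]] := filter_ex (filterI (DP u) DN).
by apply: nPi; exact: uP.
Qed.

(** The Los theorem, by induction on the rounds. Infinitely many moves on the ultracopower must be
    answered at the same index, while [D] is closed only under finite intersections; total
    boundedness leaves finitely many moves to treat. *)
Lemma ef_close_ulim n k e (V : finType) (A : V -> I -> cube_index X) :
  0 < e -> D [set i | ef_close n k e (ulim \o A) ((fun b => b i) \o A)].
Proof.
have PD : ProperFilter D by exact: ultra_proper.
have FD : Filter D by exact: filter_filter.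
elim: n V A e => [|n IH] V A e e0 /=.
  apply: filterI.
    apply: ultra_forall => p.
    have [//|DN] := in_ultra_setVsetC [set i | exists x, forall v,
      ball (ulim_fun (A v) (p i)) e (sval (A v i) x)] UD; exfalso.
    (* The unanswered points [p i] accumulate at [q]; a pair approximating [q] at a bad index [i]
       would answer [p i]. *)
    have [q pq] := @ultra_cvg I D (ultracopower X UD) p UD.
    have Dq v :
        D [set i | ball (ulim_fun (A v) q) (e / 2) (ulim_fun (A v) (p i))].
      have h := @ulim_fun_continuous (A v) q _
        (nbhsx_ballx (ulim_fun (A v) q) (e / 2) (divr_gt0 e0 (ltr0n _ 2))).
      exact: pq _ h.
    have {}Dq := @filter_forall _ V _ D FD Dq.
    have [i [x [[/= iq ni] ix]]] :=
      ultracopower_approx A q (filterI Dq DN) (divr_gt0 e0 (ltr0n _ 2)).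
    apply: ni; exists x => v; rewrite (splitr e).
    by apply: ball_triangle (ix v); exact/ball_sym/iq.
  apply: ultra_forall => x; have [p xp] := ulim_cvg x.
  have h v : D [set i | ball (sval (ulim (A v)) p) e (sval (A v i) (x i))].
    exact: (xp (A v) _ (nbhsx_ballx _ _ e0)).
  apply: filterS (@filter_forall _ V _ D FD h) => i hi.
  by exists p.
apply: filterI; last first.
  (* Moves [d i] chosen in all factors are answered by their ultralimit. *)
  apply: ultra_forall => d.
  apply: filterS (IH _ (join_env A (fun j i => d i j)) e e0) => i.
  by rewrite /= !comp_join_env => h; exists (ulim \o (fun j i => d i j)).
have e20 : 0 < e / 2 by rewrite divr_gt0.
have [T [g gP]] := ef_close_coloring k n (V + 'I_k.+1)%type e20.
(* [C t] represents the moves of colour [t] by families; a colour that no move attains gets zero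
   functions. *)
have /choice[C CP] (t : T) : exists C : 'I_k.+1 -> I -> cube_index X,
    (exists c, g _ (join_env (ulim \o A) c) = t) ->
    g _ (join_env (ulim \o A) (ulim \o C)) = t.
  have [[c ct]|no] := pselect (exists c, g _ (join_env (ulim \o A) c) = t).
    have /choice[C cC] j := ulim_surj (c j).
    exists C => _; rewrite -ct; congr (g _ (join_env _ _)).
    by apply/funext => j /=; rewrite -cC.
  by exists (fun _ _ => zero_index X).
have DC t := IH _ (join_env A (C t)) _ e20.
apply: filterS (@filter_forall _ T _ D FD DC) => i Ci c.
set t := g _ (join_env (ulim \o A) c); exists ((fun b => b i) \o C t).
have /esym/gP h : g _ (join_env (ulim \o A) (ulim \o C t)) = t.
  by apply: CP; exists c.
rewrite (splitr e); apply: ef_close_trans h _.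
by rewrite -!comp_join_env; exact: Ci.
Qed.

End UltracopowerFunctions.

(** * Maps that preserve the game distance *)

(** As [e] and [k] are arbitrary, this is dual to an embedding that is elementary for [n]
    alternating quantifier blocks of any length. *)
Definition preserves_ef n (X Y : topologicalType) (f : X -> Y)
    (cf : continuous f) :=
  forall k e (V : finType) (a : V -> cube_index Y), 0 < e ->
    ef_close n k e (pullback cf \o a) a.

(** The Los theorem for constant families, read off at any one good index. *)
Lemma preserves_ef_codiagonal n (X : compactum) (I : choiceType)
    (D : set_system I) (UD : UltraFilter D) :
  preserves_ef n (@codiagonal_continuous X I D UD).
Proof.
move=> k e V a e0; have PD : ProperFilter D by exact: ultra_proper.
have [i] := filter_ex (ef_close_ulim UD n k (fun v _ => a v) e0).
rewrite /=; congr (ef_close _ _ _ _ _); apply/funext => v /=.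
exact: ulim_cst.
Qed.

Lemma preserves_ef_homeomorphism n (X Y : topologicalType) (h : X -> Y)
    (ch : continuous h) :
  homeomorphism h -> preserves_ef n ch.
Proof.
move=> [_ [g [cg hK gK]]] k e V a e0.
have pullK : cancel (pullback cg) (pullback ch).
  by move=> b; apply: cube_index_inj => x /=; rewrite hK.
elim: n V a => [|n IH] V a /=.
  split=> x; first by exists (h x) => v; exact: ballxx.
  by exists (g x) => v; rewrite /= gK; exact: ballxx.
split=> c.
  exists (pullback cg \o c).
  have := IH _ (join_env a (pullback cg \o c)).
  rewrite comp_join_env (_ : pullback ch \o (pullback cg \o c) = c) //.
  by apply/funext => i; exact: pullK.
by exists (pullback ch \o c); rewrite -comp_join_env; exact: IH.
Qed.

(** Go around the defining square: up the codiagonal of [X], across the homeomorphism, down the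
    codiagonal of [Y], at a cost of [e / 3] each. *)
Lemma preserves_ef_coelementary n (X Y : compactum) (f : X -> Y)
    (cf : continuous f) :
  coelementary f -> preserves_ef n cf.
Proof.
move=> [_ [I [D [UD [J [E [UE [h [hh fph]]]]]]]]] k e V a e0.
have e3 : 0 < e / 3 by rewrite divr_gt0.
have -> : e = e / 3 + (e / 3 + e / 3) by lra.
pose pX := @codiagonal_continuous X I D UD.
pose pY := @codiagonal_continuous Y J E UE.
have ch := proj1 hh.
apply: ef_close_trans (ef_close_sym
  (preserves_ef_codiagonal n UD k (pullback cf \o a) e3)) _.
apply: ef_close_trans (preserves_ef_codiagonal n UE k a e3).
have := preserves_ef_homeomorphism n ch hh k (pullback pY \o a) e3.
congr (ef_close _ _ _ _ _); apply/funext => v; apply: cube_index_inj => p /=.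
by have /(congr1 (@^~ p)) /= -> := fph.
Qed.

Lemma coelementary_surj (X Y : compactum) (f : X -> Y) :
  coelementary f -> range f = setT.
Proof.
move=> [_ [I [D [UD [J [E [UE [h [[_ [g [_ hK gK]]] fph]]]]]]]]].
rewrite -subTset => y _; have [q qy] := codiagonal_surj UE y.
exists (codiagonal X UD (g q)) => //.
by have /(congr1 (@^~ (g q))) /= -> := fph; rewrite gK.
Qed.

(** A continuous surjection of compacta is closed, hence a quotient map. A positive level does not
    ask for continuity of [f] directly, so it is recovered here. *)
Lemma factor_continuous (X Y Z : compactum) (f : X -> Y) (g : Z -> Y)
    (h : Z -> X) :
  continuous g -> continuous h -> range h = setT -> g = f \o h ->
  continuous f.
Proof.
move=> cg ch sh gfh; apply/continuous_closedP => C clC.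
have -> : f @^-1` C = h @` (g @^-1` C).
  rewrite eqEsubset; split => [x Cx|_ [z Cz <-]].
    have : range h x by rewrite sh.
    by move=> [z _ zx]; exists z => //; rewrite /preimage /= gfh /= zx.
  by move: Cz; rewrite gfh.
apply: compact_closed; first exact: compactum_hausdorff.
apply: continuous_compact; first exact: continuous_subspaceT.
apply: subclosed_compact (@compactum_compact Z) _ => //.
exact: preimage_closed.
Qed.

(** Each level gains a round: a move on [X] is pulled back along [h] and answered on [Y] through the
    co-elementary [g]; a move on [Y] is answered by its pullback along [f]. *)
Lemma preserves_ef_level n (X Y : compactum) (f : X -> Y) : level_ge n f ->
  exists cf : continuous f, range f = setT /\ preserves_ef n cf.
Proof.
elim: n X Y f => [|n IH] X Y f.
  move=> [cf sf]; exists cf; split=> // k e V a e0 /=; split=> x.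
    by exists (f x) => v; exact: ballxx.
  have [z _ <-] : range f x by rewrite sf.
  by exists z => v; exact: ballxx.
move=> [Z [g [h [eg /IH[ch [sh hP]] gfh]]]].
have cg := proj1 eg.
have cf := factor_continuous cg ch sh gfh.
have gE : pullback cg = pullback ch \o pullback cf.
  by apply/funext => b; apply: cube_index_inj => z /=; rewrite gfh.
exists cf; split.
  rewrite -subTset => y _; have : range g y by rewrite coelementary_surj.
  by move=> [z _ <-]; exists (h z); rewrite ?gfh.
move=> k e V a e0; have e2 : 0 < e / 2 by rewrite divr_gt0.
split=> c; rewrite (splitr e).
  have [+ _] := preserves_ef_coelementary n.+1 cg eg k a e2.
  move=> /(_ (pullback ch \o c))[d gd]; exists d.
  apply: ef_close_trans gd.
  by rewrite gE -compA -comp_join_env; exact/ef_close_sym/hP.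
exists (pullback cf \o c); rewrite -comp_join_env.
apply: ef_close_trans (preserves_ef_coelementary n cg eg k _ e2).
by rewrite gE -compA; exact/ef_close_sym/hP.
Qed.

Lemma unit_interval_ball_eq (s t : unit_interval) :
  (forall e : R, 0 < e -> ball s e t) -> s = t.
Proof.
move=> st; apply: (@compactum_hausdorff unit_interval) => A B.
move=> /nbhs_ballP[e e0 eA] Bt; exists t; split; last exact: nbhs_singleton.
by apply: eA; exact: st.
Qed.

(** * Realizing the functions on [X] in an ultracopower of [Y] *)

Section Realize.
Variables (X Y : compactum) (n : nat) (f : X -> Y) (cf : continuous f).
Hypothesis fP : preserves_ef n.+1 cf.

Let pairs := {classic (cube_index Y * cube_index X)}.
Let z0 : pairs := (zero_index Y, zero_index X).

(** The last index lies past the end of [s] and reads [z0], so the block has the required length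
    [k.+1] with [k = size s]. *)
Let fsts (s : seq pairs) (i : 'I_(size s).+1) : cube_index Y := (nth z0 s i).1.
Let snds (s : seq pairs) (i : 'I_(size s).+1) : cube_index X := (nth z0 s i).2.

Let approx_ex (s : seq pairs) : exists d : 'I_(size s).+1 -> cube_index Y,
  ef_close n (size s) (size s).+1%:R^-1
    (join_env (pullback cf \o @fsts s) (@snds s)) (join_env (@fsts s) d).
Proof.
have e0 : 0 < (size s).+1%:R^-1 :> R by rewrite invr_gt0 ltr0n.
by have [+ _] := fP (size s) (@fsts s) e0; exact.
Qed.

Let cX := {classic cube_index X}.
Let second (z : pairs) : cX := z.2.

Let rank (b : cube_index X) (s : seq pairs) : nat :=
  index (b : cX) (map second s).

(** Using the first occurrence makes the reply depend on [b] alone, not on its partner in [s]. If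
    [b] is absent, the padding position is read. *)
Let approx (b : cube_index X) (s : seq pairs) : cube_index Y :=
  sval (cid (approx_ex s)) (inord (rank b s)).

Let approx_close k (V : finType) (a : V -> cube_index Y)
    (b : V -> cube_index X) (s : seq pairs) :
  (forall v, ((a v, b v) : pairs) \in s) -> (k <= size s)%N ->
  ef_close n k (size s).+1%:R^-1 (join_env (pullback cf \o a) b)
    (join_env a (fun v => approx (b v) s)).
Proof.
move=> abs ks.
pose r (z : V + V) : 'I_(size s).+1 + 'I_(size s).+1 :=
  match z with
  | inl v => inl (inord (index ((a v, b v) : pairs) s))
  | inr v => inr (inord (rank (b v) s)) end.
have fst_r v :
    fsts (inord (index ((a v, b v) : pairs) s) : 'I_(size s).+1) = a v.
  by rewrite /fsts inordK ?nth_index // ltnS index_size.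
have snd_r v : snds (inord (rank (b v) s) : 'I_(size s).+1) = b v.
  have bs : (b v : cX) \in map second s by apply/mapP; exists (a v, b v).
  have rs : (rank (b v) s < size s)%N.
    by rewrite -(size_map second s) index_mem.
  rewrite /snds inordK; last by rewrite ltnS ltnW.
  transitivity (nth (second z0) (map second s) (rank (b v) s)).
    by rewrite (nth_map z0).
  exact: nth_index bs.
have := ef_close_reindex r ks (svalP (cid (approx_ex s))).
congr (ef_close _ _ _ _ _); apply/funext => -[] v //=.
by rewrite fst_r.
Qed.

Variables (E : set_system (seq pairs)) (UE : UltraFilter E).
Hypothesis near_large : forall (S : seq pairs) (N : nat),
  E [set s | {subset S <= s} /\ (N <= size s)%N].

(** The future composite of [b] with the map [h] under construction. *)
Let lift (b : cube_index X) : cube_index (ultracopower Y UE) :=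
  ulim UE (approx b).

Let p : ultracopower Y UE -> Y := codiagonal Y UE.
Let cp : continuous p := @codiagonal_continuous Y (seq pairs) E UE.

(** At a list [s] that contains all the pairs, is long, and is good for the Los theorem, the finite
    approximation and the ultralimit are each within [e / 2]. *)
Let lift_close k e (V : finType) (a : V -> cube_index Y)
    (b : V -> cube_index X) : 0 < e ->
  ef_close n k e (join_env (pullback cf \o a) b)
    (join_env (pullback cp \o a) (lift \o b)).
Proof.
move=> e0; have PE : ProperFilter E by exact: ultra_proper.
have FE : Filter E by exact: filter_filter.
have e2 : 0 < e / 2 by rewrite divr_gt0.
pose N := Num.truncn (e / 2)^-1.
pose S : seq pairs := [seq (a v, b v) | v <- enum V].
have := @filterI _ _ FE _ _
  (ef_close_ulim UE n k (join_env (fun v _ => a v) (approx \o b)) e2)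
  (near_large S (maxn k N)).
move=> /filter_ex[s [los [Ss]]]; rewrite geq_max => /andP[ks Ns].
have abs v : ((a v, b v) : pairs) \in s.
  by apply: Ss; apply/mapP; exists v => //; rewrite mem_enum.
have close : ef_close n k (e / 2) (join_env (pullback cf \o a) b)
    (join_env a (fun v => approx (b v) s)).
  apply: ef_closeW (approx_close abs ks).
  rewrite invf_ple ?posrE ?ltr0n //.
  by apply: ltW; apply: lt_le_trans (truncnS_gt _) _; rewrite ler_nat ltnS.
rewrite (splitr e); apply: ef_close_trans close _; apply: ef_close_sym.
move: los; congr (ef_close _ _ _ _ _); apply/funext => -[] v //=.
exact: ulim_cst.
Qed.

(** At each [q], rank 0 closeness yields a point of [X] where one value of [pullback cf u] is close
    to both sides. *)
Let lift_pullback (u : cube_index Y) : lift (pullback cf u) = pullback cp u.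
Proof.
apply: cube_index_inj => q; apply: unit_interval_ball_eq => e e0.
have e2 : 0 < e / 2 by rewrite divr_gt0.
have [_ /(_ q)[x xq]] := ef_close_0
  (@lift_close 0 _ unit (fun=> u) (fun=> pullback cf u) e2).
rewrite (splitr e); apply: ball_triangle (xq (inl tt)).
exact/ball_sym/(xq (inr tt)).
Qed.

(** For each list some point of [X] nearly has the values prescribed at [q]; compactness gives a
    limit along [E] with the exact values. *)
Let point_ex (q : ultracopower Y UE) :
  exists x : X, forall b, sval b x = sval (lift b) q.
Proof.
have PE : ProperFilter E by exact: ultra_proper.
have FE : Filter E by exact: filter_filter.
have /choice[x xP] (s : seq pairs) : exists x : X, forall i : 'I_(size s).+1,
    ball (sval (snds i) x) (size s).+1%:R^-1 (sval (lift (snds i)) q).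
  have e0 : 0 < (size s).+1%:R^-1 :> R by rewrite invr_gt0 ltr0n.
  have [_ /(_ q)[x xq]] := ef_close_0
    (@lift_close 0 _ _ (@fsts s) (@snds s) e0).
  by exists x => i; exact: (xq (inr i)).
have [y xy] := @ultra_cvg _ E X x UE; exists y => b.
have h1 : (sval b \o x) @ E --> sval b y.
  exact: cvg_comp xy (proj2_sig b y).
apply: (cvg_unique (@compactum_hausdorff unit_interval) h1).
move=> U /nbhs_ballP[e /= e0 eU].
pose N := Num.truncn e^-1.
change (E [set s | U (sval b (x s))]).
apply: filterS (near_large [:: (zero_index Y, b)] N) => s [sub Ns].
have bs : ((zero_index Y, b) : pairs) \in s by apply: sub; rewrite inE.
have is_ : (index ((zero_index Y, b) : pairs) s < (size s).+1)%N.
  by rewrite ltnS index_size.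
apply: eU; apply: ball_sym.
have := xP s (Ordinal is_); rewrite /snds /= nth_index //=; apply: le_ball.
rewrite invf_ple ?posrE ?ltr0n //.
by apply: ltW; apply: lt_le_trans (truncnS_gt _) _; rewrite ler_nat ltnS.
Qed.

Lemma factor_through_ultracopower :
  exists (h : ultracopower Y UE -> X) (ch : continuous h),
    codiagonal Y UE = f \o h /\ preserves_ef n ch.
Proof.
have /choice[h hP] := point_ex.
have ch : continuous h.
  move=> q U /unit_interval_separates[u [V [cu Vu VU]]].
  have hu t : u (h t) = sval (lift (exist _ u cu)) t by rewrite -hP.
  rewrite hu in Vu; have nV := proj2_sig (lift (exist _ u cu)) q _ Vu.
  change (nbhs q (h @^-1` U)).
  apply: (@filterS _ (nbhs q) _ _ _ _ nV) => t Vt.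
  by apply: VU; rewrite hu.
exists h, ch; split.
  apply/funext => q; apply: unit_interval_separates_eq => u cu.
  have := lift_pullback (exist _ u cu).
  move=> /(congr1 (fun c => sval c q)) /= <-.
  by rewrite -[LHS]hP.
move=> k e V b e0; apply: ef_close_sym.
(* The parameters on [Y] are zero fillers, dropped by [inr]. *)
have := ef_close_reindex inr (leqnn k)
  (lift_close k (fun=> zero_index Y) b e0).
congr (ef_close _ _ _ _ _); apply/funext => v; apply: cube_index_inj => q /=.
by rewrite hP.
Qed.

End Realize.

(** The sets of lists that contain [S] and are at least as long form a filter base; padding [S] with
    copies of [z] enforces any length [N]. *)
Lemma ultrafilter_large_seq (T : eqType) (z : T) :
  exists E : set_system (seq T), UltraFilter E /\
    forall (S : seq T) (N : nat),
      E [set s | {subset S <= s} /\ (N <= size s)%N].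
Proof.
pose large (S s : seq T) := {subset S <= s} /\ (size S <= size s)%N.
have large_filter : ProperFilter (filter_from setT large).
  apply: filter_from_proper; last by move=> S _; exists S; split.
  apply: filter_from_filter; first by exists [::].
  move=> S S' _ _; exists (S ++ S') => // s [sub]; rewrite size_cat => Ss.
  split; split; [|exact: leq_trans (leq_addr _ _) Ss|
    |exact: leq_trans (leq_addl _ _) Ss] => t tS;
    by apply: sub; rewrite mem_cat tS ?orbT.
have [E [UE subE]] := ultraFilterLemma large_filter.
exists E; split=> // S N; apply: subE; exists (S ++ nseq N z) => // s [sub].
rewrite size_cat size_nseq => Ns; split; last first.
  exact: leq_trans (leq_addl _ _) Ns.
by move=> t tS; apply: sub; rewrite mem_cat tS.
Qed.

Lemma preserves_ef_factor (X Y : compactum) n (f : X -> Y)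
    (cf : continuous f) : preserves_ef n.+1 cf ->
  exists (I : choiceType) (D : set_system I) (UD : UltraFilter D)
    (h : ultracopower Y UD -> X) (ch : continuous h),
    codiagonal Y UD = f \o h /\ preserves_ef n ch.
Proof.
move=> fP.
have [E [UE EP]] := @ultrafilter_large_seq
  {classic (cube_index Y * cube_index X)} (zero_index Y, zero_index X).
have [h hP] := factor_through_ultracopower fP UE EP.
by exists (seq {classic (cube_index Y * cube_index X)}), E, UE, h.
Qed.

(** * Codiagonals and the characterization of levels *)

Lemma homeomorphism_codiagonal_unit (Z : compactum)
    (UD : UltraFilter (principal_filter tt)) :
  homeomorphism (codiagonal Z UD).
Proof.
split; first exact: codiagonal_continuous.
pose S := copower Z unit.
pose i (z : Z) : beta S := beta_in ((z, tt) : S).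
have ci : continuous i.
  move=> z; apply: (@continuous_comp Z S (beta S) (fun z => (z, tt))).
    move=> U [[P Q] /= [nP nQ] PQU]; apply: filterS nP => y Py.
    by apply: PQU; split=> //; exact: nbhs_singleton nQ.
  exact: beta_in_continuous.
have iS z : @ultracopower_set Z unit (principal_filter tt) (i z).
  move=> U /= Uz; apply/principal_filterP.
  by rewrite /i beta_extE in Uz; exact: nbhs_singleton Uz.
exists (fun z => exist _ (i z) (mem_set (iS z))); split.
- move=> z U [_ [[W oW <-] Wz] WU].
  change (nbhs z [set z | U (exist _ (i z) (mem_set (iS z)))]).
  have nW : nbhs z (i @^-1` W) by apply: ci; exact: open_nbhs_nbhs.
  by apply: filterS nW => y; exact: (WU (exist _ (i y) (mem_set (iS y)))).
- move=> q; apply: val_inj => /=; rewrite /codiagonal.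
  pose g := i \o beta_ext (@copower_fst_continuous Z unit).
  suff : g = id by move=> /(congr1 (@^~ (set_val q))).
  apply: beta_ext_unique.
  + by move=> r; apply: continuous_comp; [exact: beta_ext_continuous|exact: ci].
  + by move=> r; exact: cvg_id.
  + by move=> [z []]; rewrite /g /= beta_extE.
- by move=> z; rewrite /codiagonal /= /i beta_extE.
Qed.

(** In the defining square the source takes its one-point ultracopower, whose codiagonal is the
    homeomorphism. *)
Lemma coelementary_codiagonal (Y : compactum) (I : choiceType)
    (D : set_system I) (UD : UltraFilter D) :
  coelementary (codiagonal Y UD).
Proof.
split; first exact: codiagonal_continuous.
have U1 := principal_filter_ultra tt.
exists unit, (principal_filter tt), U1, I, D, UD.
exists (codiagonal (ultracopower Y UD) U1).
by split=> //; exact: homeomorphism_codiagonal_unit.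
Qed.

(** The range is closed, so a function separates it from a missed point, against closeness at rank
    0. *)
Lemma preserves_ef_surj (X Y : compactum) (f : X -> Y) (cf : continuous f) :
  preserves_ef 0 cf -> range f = setT.
Proof.
move=> fP; rewrite -subTset => y _; apply: contrapT => ny.
have clf : closed (range f).
  apply: compact_closed; first exact: compactum_hausdorff.
  apply: continuous_compact; first exact: continuous_subspaceT.
  exact: compactum_compact.
have nf : nbhs y (~` range f).
  by apply: open_nbhs_nbhs; split=> //; exact: closed_openC.
have [u [V [cu /nbhs_ballP[e /= e0 eV] VU]]] := unit_interval_separates nf.
have [_ /(_ y)[x xy]] := fP 0 e unit (fun=> exist _ u cu) e0.
have : (~` range f) (f x) by apply: VU; apply: eV; exact/ball_sym/(xy tt).
by apply; exists x.
Qed.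

Lemma level_of_preserves_ef n (X Y : compactum) (f : X -> Y)
    (cf : continuous f) :
  preserves_ef n cf -> level_ge n f.
Proof.
elim: n X Y f cf => [|n IH] X Y f cf fP.
  by split=> //; exact: preserves_ef_surj fP.
have [I [D [UD [h [ch [ph hP]]]]]] := preserves_ef_factor fP.
exists (ultracopower Y UD), (codiagonal Y UD), h; split=> //.
- exact: coelementary_codiagonal.
- exact: IH hP.
Qed.

(** The arbitrary middle compactum becomes an ultracopower of the codomain, so [h] runs between the
    two classes in the opposite direction. *)
Lemma level_factor n (X Y : compactum) (f : X -> Y) : level_ge n.+1 f ->
  exists (I : choiceType) (D : set_system I) (UD : UltraFilter D)
    (h : ultracopower Y UD -> X),
    codiagonal Y UD = f \o h /\ level_ge n h.
Proof.
move=> /preserves_ef_level[cf [_ /preserves_ef_factor]].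
move=> [I [D [UD [h [ch [ph hP]]]]]]; exists I, D, UD, h; split=> //.
exact: level_of_preserves_ef hP.
Qed.

Lemma level_pred n (X Y : compactum) (f : X -> Y) :
  level_ge n.+1 f -> level_ge n f.
Proof.
move=> /preserves_ef_level[cf [_ fP]].
apply: (level_of_preserves_ef (cf := cf)).
by move=> k e V a e0; apply: ef_close_pred; exact: fP.
Qed.

Lemma levelW m n (X Y : compactum) (f : X -> Y) :
  (m <= n)%N -> level_ge n f -> level_ge m f.
Proof.
by move=> /subnK <-; elim: (n - m)%N => // j IH; rewrite addSn => /level_pred.
Qed.

(** * Alternating the two hypotheses *)

(** The hypothesis lifts [f] to level [n.+1], and its factor [h] of level [n] goes the other way;
    the induction hypothesis for that direction raises [h], and so [f] ends one level higher. Hence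
    both directions are proved together. *)
Lemma level_add (K L : compactum -> Prop) (n : nat)
    (uK : closed_under_ultracopowers K) (uL : closed_under_ultracopowers L)
    (hKL : maps_between (level_ge n) K L = maps_between (level_ge n.+1) K L)
    (hLK : maps_between (level_ge n) L K = maps_between (level_ge n.+1) L K)
    (j : nat) :
  (forall (X Y : compactum) (f : X -> Y),
     K X -> L Y -> level_ge n f -> level_ge (n + j) f) /\
  (forall (X Y : compactum) (f : X -> Y),
     L X -> K Y -> level_ge n f -> level_ge (n + j) f).
Proof.
have up (M N : compactum -> Prop) (X Y : compactum) (f : X -> Y) :
    maps_between (level_ge n) M N = maps_between (level_ge n.+1) M N ->
    M X -> N Y -> level_ge n f -> level_ge n.+1 f.
  move=> hMN MX NY fn; have : maps_between (level_ge n) M N f by [].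
  by rewrite hMN => -[].
elim: j => [|j [IHKL IHLK]]; first by rewrite addn0.
split=> X Y f MX NY fn; rewrite addnS;
  [have := up _ _ _ _ _ hKL MX NY fn|have := up _ _ _ _ _ hLK MX NY fn];
  move=> /level_factor[I [D [UD [h [ph hn]]]]];
  exists (ultracopower Y UD), (codiagonal Y UD), h; split=> //;
  try exact: coelementary_codiagonal.
- by apply: IHLK => //; exact: uL.
- by apply: IHKL => //; exact: uK.
Qed.

Theorem theorem4p1 (K L : compactum -> Prop) (n : nat)
  (hK : closed_under_homeomorphism K) (hL : closed_under_homeomorphism L)
  (uK : closed_under_ultracopowers K) (uL : closed_under_ultracopowers L)
  (hKL : maps_between (level_ge n) K L = maps_between (level_ge (S n)) K L)
  (hLK : maps_between (level_ge n) L K = maps_between (level_ge (S n)) L K) :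
  maps_between (level_ge n) K L = maps_between level_ge_omega K L /\
  maps_between (level_ge n) L K = maps_between level_ge_omega L K.
Proof.
have stable (M N : compactum -> Prop) :
    (forall j (X Y : compactum) (f : X -> Y),
       M X -> N Y -> level_ge n f -> level_ge (n + j) f) ->
    maps_between (level_ge n) M N = maps_between level_ge_omega M N.
  move=> hMN; apply: functional_extensionality_dep => X.
  apply: functional_extensionality_dep => Y; rewrite eqEsubset.
  split=> f [MX NY fn]; split=> //.
  (* Level [m] is reached by descending from level [n + m]. *)
  by move=> m; apply: levelW (leq_addl n m) _; exact: hMN.
by split; apply: stable => j; have [] := level_add uK uL hKL hLK j.
Qed.
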